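(* Let $\Omega$ be a locally compact Hausdorff space with countable base, let $\sigma\in\mathcal{M}^+(\Omega)$ and $0<q<1$. Suppose $G\colon\Omega\times\Omega\to[0,+\infty]$ is a lower semicontinuous, quasi-symmetric kernel, non-degenerate with respect to $\sigma$, which satisfies the weak maximum principle. Consider the inequality $$(\ast)\qquad \|\mathbf{G}\nu\|_{L^q(\Omega,\sigma)}\le\varkappa\,\|\nu\|\quad\text{for all }\nu\in\mathcal{M}^+(\Omega),$$ for some constant $\varkappa>0$. (1) If $(\ast)$ holds for some $\varkappa$, then $\mathbf{G}\sigma\in L^{\frac{q}{1-q}}(\Omega,\sigma)$. (2) If $\mathbf{G}\sigma\in L^{\frac{q}{1-q},q}(\Omega,\sigma)$, then $(\ast)$ holds for some $\varkappa$.
   Context: $\mathcal{M}^+(\Omega)$ is the class of nonnegative, locally finite Borel (Radon) measures on $\Omega$; $\|\nu\|=\nu(\Omega)$; $S_\nu$ is the support of $\nu$; $\mathbf{G}\nu(x)=\int_\Omega G(x,y)\,d\nu(y)$. $L^{s,q}(\Omega,\sigma)$ is the Lorentz space, i.e. measurable $f$ with $\int_0^\infty t^{q-1}\,\sigma(\{|f|>t\})^{q/s}\,dt<\infty$. $G$ is quasi-symmetric if there is a constant $a>0$ with $a^{-1}G(y,x)\le G(x,y)\le a\,G(y,x)$ for all $x,y\in\Omega$. $G$ satisfies the weak maximum principle (with constant $h\ge1$) if, for every constant $M>0$ and every $\nu\in\mathcal{M}^+(\Omega)$, the inequality $\mathbf{G}\nu(x)\le M$ for all $x\in S_\nu$ implies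 $\mathbf{G}\nu(x)\le hM$ for all $x\in\Omega$. $G$ is degenerate with respect to $\sigma$ if there is a set $A\subset\Omega$ with $\sigma(A)>0$ such that, for every $y\in A$, $G(\cdot,y)=0$ $d\sigma$-a.e.; otherwise $G$ is non-degenerate with respect to $\sigma$. *)

(* Defs.v *)
From mathcomp Require Import all_boot all_order all_algebra.
From mathcomp Require Import all_classical all_reals all_analysis.
From mathcomp Require Import measurable_realfun.

Set Implicit Arguments.
Unset Strict Implicit.
Unset Printing Implicit Defensive.
Import Order.TTheory GRing.Theory Num.Theory.
Import numFieldNormedType.Exports.

Local Open Scope classical_set_scope.
Local Open Scope ring_scope.
Local Open Scope ereal_scope.

(* [measurableType]s are pointed, hence [ptopologicalType] below; the base
   point plays no role. *)
Notation borel T := (g_sigma_algebraType (@open T)).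

Section Potential.
Context {R : realType} {T : ptopologicalType}.
Implicit Types (mu nu sigma : {measure set (borel T) -> \bar R}).
Implicit Types (G : T -> T -> \bar R).

(* On a locally compact Hausdorff space with countable base, this makes a
   Borel measure a Radon measure: regularity is automatic. *)
Definition locally_finite mu : Prop :=
  forall x : T, exists2 U : set T, open_nbhs x U & mu U < +oo.

Definition measure_support mu : set T :=
  [set x | forall U : set T, open_nbhs x U -> 0 < mu U].

Definition potential G nu (x : T) : \bar R := \int[nu]_y G x y.

Definition quasi_symmetric G : Prop :=
  exists2 a : R, (0 < a)%R &
    forall x y, (a^-1)%:E * G y x <= G x y <= a%:E * G y x.

Definition weak_maximum_principle (h : R) G : Prop :=
  forall (M : R) nu, (0 < M)%R -> locally_finite nu ->
    (forall x, measure_support nu x -> potential G nu x <= M%:E) ->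
    forall x, potential G nu x <= (h * M)%:E.

Definition degenerate sigma G : Prop :=
  exists A : set (borel T), [/\ measurable A, 0 < sigma A &
    forall y, A y -> {ae sigma, forall x, G x y = 0}].

(* The library's [Lfun] covers real-valued functions and exponents at least 1
   only. *)
Definition in_Lp sigma (p : R) (f : borel T -> \bar R) : Prop :=
  measurable_fun [set: borel T] f /\ 'N[sigma]_(p%:E)[f] < +oo.

Definition in_Lorentz sigma (s q : R) (f : borel T -> \bar R) : Prop :=
  measurable_fun [set: borel T] f /\
  \int[lebesgue_measure]_(t in `]0%R, +oo[)
    ((t `^ (q - 1))%:E * sigma [set x | t%:E < `|f x|] `^ (q / s)) < +oo.

Definition strong_type_inequality sigma G (q kappa : R) : Prop :=
  forall nu, locally_finite nu ->
    'N[sigma]_(q%:E)[potential G nu] <= kappa%:E * nu setT.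

End Potential.

(* Main.v *)
Require Import Defs.
From HB Require Import structures.
From mathcomp Require Import all_boot all_order all_algebra.
From mathcomp Require Import all_classical all_reals all_analysis.
From mathcomp Require Import measurable_realfun.
From mathcomp Require Import ring.

(* Write [u] for the potential of [sigma] and [r = q / (1 - q)].

   Necessity: fix [x] and put [t = u x / (2 h)]. The potential of [sigma]
   restricted to the closed set [u <= t] is at most [t] on that set, hence at
   most [h t = u x / 2] everywhere, so half of [u x] comes from [u > t]. This
   yields [c * u ^ (r + 1) <= G (u ^ r sigma)] pointwise. Testing the strong type
   inequality on [nu = u ^ r sigma], and using [(r + 1) q = r], gives
   [c ^ q * I <= (kappa I) ^ q] with [I] the integral of [u ^ r]; this bounds [I]
   once [I] is known to be finite, so the argument is run on restrictions of
   [sigma] to sets on which everything is bounded, and these exhaust the space.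

   Sufficiency: on the shell [D_k = {e^k < u <= e^(k+1)}] the maximum principle
   bounds the potential of [sigma] restricted to [D_k] by [h e^(k+1)] everywhere,
   so by Tonelli and quasi-symmetry the integral of [G nu] over [D_k] is at most
   [a h e^(k+1) |nu|]. Interpolating between [L^1] and the measure of [D_k] bounds
   the integral of [(G nu) ^ q] over [D_k] by a multiple of
   [|nu|^q e^(k q) sigma(u > e^k) ^ (1 - q)], and the sum of these over [k] is
   controlled by the Lorentz integral. Non-degeneracy discards [u = 0]. *)

Import Order.TTheory GRing.Theory Num.Theory.
Import numFieldNormedType.Exports.

Local Open Scope classical_set_scope.
Local Open Scope ring_scope.
Local Open Scope ereal_scope.
Set Implicit Arguments.
Unset Strict Implicit.

(** * Extended reals and measures *)

(** Lower semicontinuity tests real levels only, so inequalities between extended reals are reduced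
    to these; [+oo] is detected by lying above every real. *)
Lemma lee_real_lt (R : realType) (x y : \bar R) :
  (forall r, r%:E < x -> r%:E <= y) -> x <= y.
Proof.
case: x => [x| |] xy; last exact: leNye.
- apply/lee_subgt0Pr => e e0; apply: xy.
  by rewrite lte_fin ltrBlDr ltrDl.
- by rewrite (eq_infty (fun r => xy r (ltry r))).
Qed.

Lemma limn_einf_ge (R : realType) (u : (\bar R)^nat) b N :
  (forall n, (N <= n)%N -> b <= u n) -> b <= limn_einf u.
Proof.
move=> bu; rewrite limn_einf_lim (cvg_lim _ (@cvg_einfs_sup _ u))//.
apply: (@le_trans _ _ (einfs u N)).
  by apply: le_ereal_inf_tmp => _ [n /= Nn <-]; exact: bu.
by apply: ereal_sup_ubound; exists N.
Qed.

Lemma limn_einf_le (R : realType) (u : (\bar R)^nat) b :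
  (forall n, u n <= b) -> limn_einf u <= b.
Proof.
move=> ub; rewrite limn_einf_lim (cvg_lim _ (@cvg_einfs_sup _ u))//.
apply: ge_ereal_sup => _ [n _ <-].
by apply: (le_trans _ (ub n)); apply: ereal_inf_lbound; exists n => /=.
Qed.

Lemma le_poweR (R : realType) (x y : \bar R) (s : R) :
  (0 <= s)%R -> 0 <= x -> x <= y -> x `^ s <= y `^ s.
Proof.
move=> s0 x0 xy; have y0 := le_trans x0 xy.
by apply: gt0_ler_poweR; rewrite ?in_itv/= ?leey ?x0 ?y0.
Qed.

(** The powers [r] and [r^-1] are order preserving and mutually inverse on nonnegative extended
    reals, hence preserve suprema. *)
Lemma nondecreasing_cvg_poweR (R : realType) (u : (\bar R)^nat) (l : \bar R) (r : R) :
  (0 < r)%R -> (forall n, 0 <= u n) -> nondecreasing_seq u ->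
  u @ \oo --> l -> u n `^ r @[n --> \oo] --> l `^ r.
Proof.
move=> r0 u0 ndu ul.
have -> : l = ereal_sup (range u).
  by rewrite -(cvg_lim _ ul)//; apply: cvg_lim => //; exact: ereal_nondecreasing_cvgn.
have ndr : nondecreasing_seq (fun n => u n `^ r).
  by move=> m n mn; apply: le_poweR (ltW r0) _ _ => //; exact: ndu.
have := ereal_nondecreasing_cvgn ndr; set S := ereal_sup _.
have uS n : u n `^ r <= S by apply: ereal_sup_ubound; exists n.
have S0 : 0 <= S by apply: le_trans (uS 0%N); exact: poweR_ge0.
suff -> : S = ereal_sup (range u) `^ r by [].
apply/eqP; rewrite eq_le; apply/andP; split.
  apply: ge_ereal_sup => _ [n _ <-]; apply: le_poweR (ltW r0) _ _ => //.
  by apply: ereal_sup_ubound; exists n.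
have -> : S = (S `^ r^-1) `^ r by rewrite -poweRrM mulVf ?gt_eqF// poweRe1.
apply: le_poweR (ltW r0) _ _ => //.
  by apply: (le_trans (u0 0%N)); apply: ereal_sup_ubound; exists 0%N.
apply: ge_ereal_sup => _ [n _ <-].
have -> : u n = (u n `^ r) `^ r^-1 by rewrite -poweRrM mulfV ?gt_eqF// poweRe1.
by apply: le_poweR; rewrite ?invr_ge0 ?(ltW r0) ?poweR_ge0.
Qed.

(** For positive [i], dividing by the finite number [i ^ q] leaves [i ^ (1 - q) <= (k / c) ^ q]. *)
Lemma powR_self_bound (R : realType) (q c k i : R) :
  (0 < q < 1)%R -> (0 < c)%R -> (0 < k)%R -> (0 <= i)%R ->
  (c `^ q * i <= (k * i) `^ q)%R -> (i <= (k / c) `^ (q / (1 - q)))%R.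
Proof.
move=> /andP[q0 q1] c0 k0; rewrite le_eqVlt => /predU1P[<- _|i0].
  exact: powR_ge0.
have p0 : (0 < 1 - q)%R by rewrite subr_gt0.
have iq0 : (0 < i `^ q)%R by exact: powR_gt0.
have cq0 : (0 < c `^ q)%R by exact: powR_gt0.
have [[c0' k0'] i0'] := (ltW c0, ltW k0, ltW i0).
rewrite (powRM _ k0' i0') => le1.
have le2 : (i `^ (1 - q) <= (k / c) `^ q)%R.
  rewrite powRM ?invr_ge0// -powR_inv1// powRAC powR_inv1 ?powR_ge0//.
  rewrite ler_pdivlMr// -(ler_pM2r iq0) mulrAC -powRD; last first.
    by rewrite subrK oner_eq0.
  by rewrite subrK powRr1// mulrC.
rewrite -[leLHS](powRr1 i0') -[X in (i `^ X)%R](@divff _ (1 - q)%R) ?gt_eqF//.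
rewrite !powRrM.
by rewrite ge0_ler_powR// ?nnegrE ?powR_ge0// invr_ge0 (ltW p0).
Qed.

(** * Integrals against restricted measures and densities *)

Section integral_mrestr.
Context {d : measure_display} {T : measurableType d} {R : realType}.
Implicit Types (mu : {measure set T -> \bar R}) (f g : T -> \bar R).

Lemma ge0_integral_mrestr mu (D : set T) (mD : measurable D) f :
  measurable_fun [set: T] f -> (forall x, 0 <= f x) ->
  \int[mrestr mu mD]_x f x = \int[mu]_(x in D) f x.
Proof.
move=> mf f0.
have mCD : measurable (~` D) by exact: measurableC.
rewrite -(setUv D) ge0_integral_setU ?setUv//; last exact/disj_set2P/setICr.
rewrite [X in _ + X](_ : _ = 0) ?adde0; last first.
  apply: null_set_integral => //; first exact: measurable_funTS.
  by rewrite /= /mrestr setICl measure0.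
apply: eq_measure_integral => A mA AD /=; rewrite /mrestr.
by rewrite setIidl.
Qed.

Definition mdensity mu f (A : set T) : \bar R := \int[mu]_(x in A) f x.

Section density.
Variables (mu : {measure set T -> \bar R}) (f : T -> \bar R).
Hypotheses (mf : measurable_fun [set: T] f) (f0 : forall x, 0 <= f x).

Let density0 : mdensity mu f set0 = 0.
Proof. by rewrite /mdensity integral_set0. Qed.

Let density_ge0 A : 0 <= mdensity mu f A.
Proof. exact: integral_ge0. Qed.

Let density_sigma_additive : semi_sigma_additive (mdensity mu f).
Proof.
move=> F mF tF mU; rewrite /mdensity ge0_integral_bigcup//.
  by apply: is_cvg_ereal_nneg_natsum => n _; exact: integral_ge0.
exact: measurable_funTS.
Qed.

(* The proofs are arguments so that the measure instance can be inferred. *)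
Definition density_measure of measurable_fun [set: T] f & (forall x, 0 <= f x) :=
  mdensity mu f.

HB.instance Definition _ := isMeasure.Build _ _ _ (density_measure mf f0)
  density0 density_ge0 density_sigma_additive.

Import HBNNSimple.

(** Simple functions increasing to [g] reduce the identity to indicators; as [f x] is finite,
    multiplying by it preserves the limit. *)
Lemma ge0_integral_density g : (forall x, f x \is a fin_num) ->
  measurable_fun [set: T] g -> (forall x, 0 <= g x) ->
  \int[density_measure mf f0]_x g x = \int[mu]_x (g x * f x).
Proof.
move=> ffin mg g0; pose h := nnsfun_approx measurableT mg.
have hg x : EFin \o h ^~ x @ \oo --> g x by exact: cvg_nnsfun_approx.
have mh n : measurable_fun [set: T] (fun x => (h n x)%:E) by exact/measurable_EFinP.
have ndh x : nondecreasing_seq (fun n => (h n x)%:E).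
  by move=> m n mn; rewrite lee_fin; exact/lefP/nd_nnsfun_approx.
have h0 n x : 0 <= (h n x)%:E by rewrite lee_fin.
have -> : \int[density_measure mf f0]_x g x =
    limn (fun n => \int[density_measure mf f0]_x (h n x)%:E).
  rewrite -monotone_convergence//.
  by apply: eq_integral => x _; apply/esym/cvg_lim => //; exact: hg.
have -> : \int[mu]_x (g x * f x) =
    limn (fun n => \int[mu]_x ((h n x)%:E * f x)).
  rewrite -monotone_convergence//; last 3 first.
  - by move=> n; exact: emeasurable_funM.
  - by move=> n x _; exact: mule_ge0.
  - move=> x _ m n mn; apply: lee_wpmul2r => //; exact: ndh.
  apply: eq_integral => x _; apply/esym/cvg_lim => //.
  exact: (cvgeZr (ffin x) (hg x)).
congr (limn _); apply/funext => n.
transitivity (\sum_(r \in range (h n)) r%:E * mdensity mu f (h n @^-1` [set r])).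
  by rewrite integralT_nnsfun sintegralE.
under [RHS]eq_integral => x _.
  rewrite (fimfunE (h n) x) -fsumEFin// ge0_mule_fsuml; last first.
    by move=> r; exact: nnfun_muleindic_ge0.
  over.
rewrite ge0_integral_fsum//; last 2 first.
- move=> r; apply: emeasurable_funM => //.
  exact/measurable_EFinP/measurable_funM.
- by move=> r x _; apply: mule_ge0 => //; exact: nnfun_muleindic_ge0.
apply: eq_fsbigr => r /[!inE] -[z _ <-].
under eq_integral do rewrite EFinM -muleA.
have hz0 : 0 <= (h n z)%:E by rewrite lee_fin.
rewrite ge0_integralZl//=; last 2 first.
- by apply: emeasurable_funM => //; exact/measurable_EFinP.
- by move=> x _; apply: mule_ge0 => //; rewrite lee_fin.
congr (_ * _); rewrite /mdensity integral_mkcond.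
by apply: eq_integral => x _; rewrite epatch_indic muleC.
Qed.

End density.
End integral_mrestr.

Lemma tonelli_sigma_finite {d1 d2 : measure_display} {T1 : measurableType d1}
    {T2 : measurableType d2} {R : realType}
    (m1 : {measure set T1 -> \bar R}) (m2 : {measure set T2 -> \bar R})
    (f : T1 * T2 -> \bar R) :
  sigma_finite [set: T1] m1 -> sigma_finite [set: T2] m2 ->
  measurable_fun [set: T1 * T2] f -> (forall z, 0 <= f z) ->
  \int[m1]_x \int[m2]_y f (x, y) = \int[m2]_y \int[m1]_x f (x, y).
Proof.
move=> sf1 sf2 mf f0.
pose s1 := sfinite_measure_sigma_finite sf1.
pose s2 := sfinite_measure_sigma_finite sf2.
pose H1 := isSFinite.Build _ _ _ _ s1.
pose H2 := isSFinite.Build _ _ _ _ s2.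
pose K1 := isSigmaFinite.Build _ _ _ _ sf1.
pose K2 := isSigmaFinite.Build _ _ _ _ sf2.
pose m1' := HB.pack_for (SigmaFiniteMeasure.type T1 R) (Measure.sort m1) H1 K1.
pose m2' := HB.pack_for (SigmaFiniteMeasure.type T2 R) (Measure.sort m2) H2 K2.
exact: (@fubini_tonelli _ _ _ _ _ m1' m2' f mf f0).
Qed.

Lemma integral_poweR_le {d : measure_display} {T : measurableType d} {R : realType}
    (mu : {measure set T -> \bar R}) (D : set T) (f : T -> \bar R) (q A m : R) :
  (0 < q < 1)%R -> (0 < A)%R -> (0 < m)%R -> measurable D ->
  measurable_fun D f -> (forall x, 0 <= f x) ->
  mu D <= m%:E -> \int[mu]_(x in D) f x <= A%:E ->
  \int[mu]_(x in D) (f x `^ q) <= (2 * (A `^ q * m `^ (1 - q)))%:E.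
Proof.
move=> /andP[q0 q1] A0 m0 mD mf f0 Dm fA.
(* With this [l], both [(l ^ q / l) * A] and [l ^ q * m] equal [A ^ q * m ^ (1 - q)], whence the
   factor 2. *)
pose l := (A / m)%R; have l0 : (0 < l)%R by exact: divr_gt0.
have lq0 : (0 <= l `^ q)%R by exact: powR_ge0.
have lql0 : (0 <= l `^ q / l)%R by rewrite divr_ge0// ltW.
(* At a finite value [v] this is [w ^ q <= w + 1] for [w = v / l], scaled by [l ^ q]. *)
have pointwise x : f x `^ q <= (l `^ q / l)%:E * f x + (l `^ q)%:E.
  have := f0 x; case: (f x) => [v| |]//; last first.
    by move=> _; rewrite gt0_muley ?addye ?leey// lte_fin divr_gt0// powR_gt0.
  rewrite lee_fin => v0; rewrite poweR_EFin -EFinM -EFinD lee_fin.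
  have -> : (v `^ q = l `^ q * (v / l) `^ q)%R.
    rewrite -powRM ?(ltW l0)//; last exact: divr_ge0 (ltW l0).
    by rewrite [X in (_ = X `^ q)%R]mulrCA divff ?mulr1// gt_eqF.
  rewrite -mulrA -[X in (_ <= _ + X)%R]mulr1 -mulrDr ler_wpM2l// [(l^-1 * v)%R]mulrC.
  set w := (v / l)%R; have w0 : (0 <= w)%R by rewrite divr_ge0// ltW.
  have [w1|w1] := leP w 1%R.
    have : (w `^ q <= 1 `^ q)%R by rewrite ge0_ler_powR// ?nnegrE// ltW.
    by rewrite powR1 => /le_trans; apply; rewrite lerDr.
  have : (w `^ q <= w `^ 1)%R by rewrite ler_powR// ltW.
  by rewrite powRr1// => /le_trans; apply; rewrite lerDl.
apply: (@le_trans _ _ (\int[mu]_(x in D) ((l `^ q / l)%:E * f x + (l `^ q)%:E))).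
  apply: ge0_le_integral => //.
  - by move=> x _; exact: poweR_ge0.
  - exact: (measurableT_comp (measurable_poweR q)).
  - by apply: emeasurable_funD => //; exact: measurable_funeM.
have mlf : measurable_fun D (fun x => (l `^ q / l)%:E * f x).
  exact: measurable_funeM.
rewrite ge0_integralD//; last by move=> x _; rewrite mule_ge0.
rewrite ge0_integralZl// integral_cst//.
apply: (@le_trans _ _ ((l `^ q / l)%:E * A%:E + (l `^ q)%:E * m%:E)).
  by apply: leeD; apply: lee_wpmul2l.
rewrite -!EFinM -EFinD lee_fin.
have -> : (A `^ q * m `^ (1 - q) = l `^ q * m)%R.
  rewrite powRB ?powRr1 ?(ltW m0)//; last by rewrite gt_eqF ?implybT.
  rewrite /l powRM ?invr_ge0 ?(ltW m0) ?(ltW A0)//.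
  rewrite -[(m^-1)%R]powR_inv1 ?(ltW m0)// powRAC powR_inv1 ?powR_ge0//.
  by rewrite mulrAC mulrA.
by rewrite le_eqVlt; apply/orP; left; apply/eqP; rewrite /l; field; rewrite !gt_eqF.
Qed.

Lemma ge0_integral_bigcup_le {d1 d2 : measure_display} {T1 : measurableType d1}
    {T2 : measurableType d2} {R : realType} {K : countType}
    (m1 : {measure set T1 -> \bar R}) (m2 : {measure set T2 -> \bar R})
    (D : K -> set T1) (E : K -> set T2) (f : T1 -> \bar R) (g : T2 -> \bar R)
    (c : R) :
  (forall k, measurable (D k)) -> (forall k, measurable (E k)) ->
  trivIset setT D -> trivIset setT E ->
  measurable_fun (\bigcup_k D k) f -> measurable_fun (\bigcup_k E k) g ->
  (forall x, 0 <= f x) -> (forall x, (\bigcup_k E k) x -> 0 <= g x) -> (0 <= c)%R ->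
  (forall k, \int[m1]_(x in D k) f x <= c%:E * \int[m2]_(x in E k) g x) ->
  \int[m1]_(x in \bigcup_k D k) f x <= c%:E * \int[m2]_(x in \bigcup_k E k) g x.
Proof.
move=> mD mE tD tE mf mg f0 g0 c0 fg.
(* The index type is enumerated through its coding by naturals; a natural that codes nothing gives
   the empty set. *)
pose seq_of T (S : K -> set T) n : set T := if pickle_inv n is Some k then S k else set0.
have bigcup_seq T (S : K -> set T) : \bigcup_k S k = \bigcup_n seq_of _ S n.
  apply/seteqP; split => [x [k _ Sx]|x [n _]].
    by exists (pickle k) => //; rewrite /seq_of pickleK_inv.
  by rewrite /seq_of; case: pickle_inv => // k Sx; exists k.
have triv_seq T (S : K -> set T) : trivIset setT S -> trivIset setT (seq_of _ S).
  move=> tS i j _ _ [x []]; rewrite /seq_of.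
  have := @pickle_invK K i; have := @pickle_invK K j.
  case: (pickle_inv j) => [l|//] /= <-; case: (pickle_inv i) => [k|//] /= <- Sk Sl.
  by congr pickle; apply: tS => //; exists x.
have m_seq T d (X : measurableType d) (S : K -> set X) :
    (forall k, measurable (S k)) -> forall n, measurable (seq_of _ S n).
  by move=> mS n; rewrite /seq_of; case: pickle_inv.
rewrite !bigcup_seq in mf mg g0 *.
rewrite !ge0_integral_bigcup//; try by [exact: m_seq|exact: triv_seq].
rewrite -nneseriesZl//; last by move=> n _; apply: integral_ge0 => x Ex; apply: g0; exists n.
apply: lee_nneseries => n _; first by move=> _; exact: integral_ge0.
by rewrite /seq_of; case: pickle_inv => //; rewrite !integral_set0 mule0.
Qed.

(** * Potentials of lower semicontinuous kernels *)

Section borel_lsc.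
Context {R : realType} {T : ptopologicalType}.

Lemma open_borel_measurable (A : set T) : open A -> measurable (A : set (borel T)).
Proof. by move=> oA; exact: sub_sigma_algebra. Qed.

Lemma lsc_borel_measurable (f : borel T -> \bar R) :
  lower_semicontinuous (f : T -> \bar R) -> measurable_fun [set: borel T] f.
Proof.
move=> lf; apply: (measurability _ (ErealGenOInfty.measurableE R)).
move=> /= _ [_ [a ->]] <-; rewrite setTI preimage_itvoy.
by apply: open_borel_measurable; exact: (lower_semicontinuousP f).1.
Qed.

Lemma second_countable_basis_seq : @second_countable T ->
  exists2 U : (set T)^nat, (forall n, open (U n)) &
    forall x A, nbhs x A -> exists n, U n x /\ U n `<=` A.
Proof.
move=> [B cB [oB fB]].
have [|[f]] := pfcard_geP cB.
  move=> B0; have /(_ _ filterT)[V [VB _] _] := fB point.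
  by rewrite B0 in VB.
exists f => [n|x A /fB[V /= [BV Vx] VA]].
  by apply: oB; exact: funS.
by have [n _ fnV] := 'surj_f BV; exists n; rewrite fnV.
Qed.

(** By the countable base, each open subset of the product is a countable union of open rectangles,
    hence lies in the product of the Borel sigma-algebras. *)
Lemma lsc_measurable_prod (f : borel T * borel T -> \bar R) :
  @second_countable T -> lower_semicontinuous (f : T * T -> \bar R) ->
  measurable_fun [set: borel T * borel T] f.
Proof.
move=> /second_countable_basis_seq[U oU bU] lf.
apply: (measurability _ (ErealGenOInfty.measurableE R)).
move=> /= _ [_ [a ->]] <-; rewrite setTI preimage_itvoy.
set O := [set x | _].
have oO : open (O : set (T * T)) by exact: (lower_semicontinuousP _).1.
have -> : O = \bigcup_i \bigcup_(j in [set j | U i `*` U j `<=` O]) (U i `*` U j).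
  apply/seteqP; split => [[x y] Oxy|z [i _ [j /= UO Uz]]]; last exact: UO.
  have /= [[A B] /= [Ax By] ABO] : nbhs ((x, y) : T * T) O.
    exact: open_nbhs_nbhs.
  have [i [Uix UiA]] := bU _ _ Ax.
  have [j [Ujy UjB]] := bU _ _ By.
  exists i => //; exists j => //= -[x' y'] /= [Ux' Uy'].
  by apply: ABO; split; [exact: UiA|exact: UjB].
apply: bigcup_measurable => i _; apply: bigcup_measurable => j _.
by apply: measurableX; exact: open_borel_measurable.
Qed.

End borel_lsc.

(** * Measurability and semicontinuity of potentials *)

Section kernel_potential.
Context {R : realType} {T : ptopologicalType}.
Variable (G : T -> T -> \bar R).
Hypothesis T2c : @second_countable T.
Hypothesis G0 : forall x y, 0 <= G x y.
Hypothesis lscG : lower_semicontinuous (fun xy : T * T => G xy.1 xy.2).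
Implicit Types mu nu : {measure set (borel T) -> \bar R}.

Lemma measurable_kernel :
  measurable_fun [set: borel T * borel T] (fun xy => G xy.1 xy.2).
Proof. exact: lsc_measurable_prod. Qed.

Lemma measurable_kernel_section x :
  measurable_fun [set: borel T] (G x : borel T -> \bar R).
Proof.
exact: (measurableT_comp measurable_kernel (measurable_pair1 (x : borel T))).
Qed.

(* A countable base lets sequences test lower semicontinuity, so that Fatou's
   lemma applies. *)
Lemma lsc_potential nu : lower_semicontinuous (potential G nu).
Proof.
have [U oU bU] := second_countable_basis_seq T2c.
move=> x a aGx; apply: contrapT => noV.
(* The negation yields points [z n], lying in every [U i] with [i <= n] that contains [x], hence
   tending to [x], with potential at most [a]. *)
have ex n : exists z, (forall i, (i <= n)%N -> U i x -> U i z) /\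
    potential G nu z <= a%:E.
  have nV : \forall z \near x, forall i : 'I_n.+1, U i x -> U i z.
    apply: filter_forall => i; have [Ux|Ux] := pselect (U i x).
      have : nbhs x (U i) by exact: open_nbhs_nbhs.
      by apply: filterS => z Uz _.
    by apply: nearW => z /Ux.
  apply: contrapT => nz; apply: noV.
  exists [set z | forall i : 'I_n.+1, U i x -> U i z] => // z Uz.
  rewrite ltNge; apply/negP => zle; apply: nz; exists z; split => // i ni Ux.
  exact: (Uz (Ordinal (ni : (i < n.+1)%N))).
have [z zP] := choice ex.
suff : potential G nu x <= a%:E by rewrite leNgt aGx.
apply: (@le_trans _ _ (\int[nu]_y limn_einf (fun n => G (z n) y))); last first.
  apply: (le_trans (fatou _ _ _ _)) => //.
    by move=> n; exact: measurable_kernel_section.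
  by apply: limn_einf_le => n; exact: (zP n).2.
apply: ge0_le_integral => //.
- exact: measurable_kernel_section.
- apply: measurableT_comp => //; apply: measurable_fun_limn_esup => n.
  by apply: measurableT_comp => //; exact: measurable_kernel_section.
(* A rectangle around [(x, y)] on which [G > r] contains [(z n, y)] once [n] passes the index of a
   basic set inside its first side. *)
move=> y _; apply: lee_real_lt => r rG.
have [V Vxy VG] := (lscG : forall xy r, _) ((x, y) : T * T) r rG.
case: Vxy => -[A B] /= [Ax By] ABV.
have [i [Uix UiA]] := bU _ _ Ax.
apply: (@limn_einf_ge _ _ _ i) => n ni; apply/ltW/(VG (z n, y))/ABV; split => /=.
  by apply: UiA; exact: (zP n).1.
exact: nbhs_singleton.
Qed.

End kernel_potential.

Section locally_finite.
Context {R : realType} {T : ptopologicalType}.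
Implicit Types mu : {measure set (borel T) -> \bar R}.

(** Each point has a neighbourhood of finite measure, so the basic open sets of finite measure
    already cover the space; the others are replaced by the empty set. *)
Lemma locally_finite_sigma_finite mu :
  @second_countable T -> locally_finite mu -> sigma_finite [set: borel T] mu.
Proof.
move=> /second_countable_basis_seq[U oU bU] lmu.
have mU n := open_borel_measurable (oU n).
exists (fun n => if mu (U n) < +oo then U n else set0).
  apply/esym; rewrite -subTset => x _.
  have [V [oV Vx] muV] := lmu x.
  have [n [Unx UnV]] := bU x V (open_nbhs_nbhs (conj oV Vx)).
  exists n => //; rewrite ifT//; apply: le_lt_trans muV.
  have mV := open_borel_measurable oV.
  by apply: le_measure; rewrite ?inE.
by move=> n; case: ifPn => // Un; rewrite measure0.
Qed.

Lemma finite_locally_finite mu : mu setT < +oo -> locally_finite mu.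
Proof. by move=> mufin x; exists setT => //; split => //; exact: openT. Qed.

Lemma locally_finite_mrestr mu (D : set (borel T)) (mD : measurable D) :
  locally_finite mu -> locally_finite (mrestr mu mD).
Proof.
move=> lmu x; have [V [oV Vx] muV] := lmu x.
exists V => //; apply: le_lt_trans muV; have mV := open_borel_measurable oV.
by rewrite /= /mrestr; apply: le_measure; rewrite ?inE//; exact: measurableI.
Qed.

End locally_finite.

(** * The weak maximum principle for restrictions of [sigma] *)

Section maximum_principle.
Context {R : realType} {T : ptopologicalType}.
Variables (G : T -> T -> \bar R) (h : R).
Hypothesis T2c : @second_countable T.
Hypothesis G0 : forall x y, 0 <= G x y.
Hypothesis lscG : lower_semicontinuous (fun xy : T * T => G xy.1 xy.2).
Hypothesis wmp : weak_maximum_principle h G.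
Variable sigma : {measure set (borel T) -> \bar R}.
Hypothesis lsigma : locally_finite sigma.

(** Integrals of the kernel over [D] are thus potentials, to which semicontinuity and the maximum
    principle apply. *)
Lemma potential_mrestr (D : set (borel T)) (mD : measurable D) x :
  potential G (mrestr sigma mD) x = \int[sigma]_(y in D) G x y.
Proof.
rewrite /potential ge0_integral_mrestr//; exact: measurable_kernel_section.
Qed.

Lemma lsc_integral_kernel (D : set (borel T)) : measurable D ->
  lower_semicontinuous (fun x : T => \int[sigma]_(y in D) G x y).
Proof.
move=> mD; under eq_fun do rewrite -(potential_mrestr mD).
exact: lsc_potential.
Qed.

Lemma measurable_integral_kernel (D E : set (borel T)) : measurable D ->
  measurable_fun E (fun x => \int[sigma]_(y in D) G x y).
Proof.
move=> mD; apply: measurable_funTS.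
by apply: lsc_borel_measurable; exact: lsc_integral_kernel.
Qed.

Lemma closed_lsc_le (f : T -> \bar R) (M : R) :
  lower_semicontinuous f -> closed [set x | f x <= M%:E].
Proof.
move=> /lower_semicontinuousP/(_ M) oM.
rewrite -openC (_ : ~` _ = [set x | M%:E < f x])//.
by apply/seteqP; split => x /=; rewrite ltNge => /negP.
Qed.

(* The support of a restriction is only contained in the closure of the set,
   hence the closed set [C]. *)
Lemma integral_kernel_le (D C : set (borel T)) (M : R) : (0 < M)%R ->
  measurable D -> closed (C : set T) -> D `<=` C ->
  (forall x, C x -> \int[sigma]_(y in D) G x y <= M%:E) ->
  forall x, \int[sigma]_(y in D) G x y <= (h * M)%:E.
Proof.
move=> M0 mD cC DC DM x; rewrite -(potential_mrestr mD).
apply: wmp => //; first exact: locally_finite_mrestr.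
(* A support point outside [C] would have the complement of [C] as a neighbourhood, but this misses
   [D] and so is null for the restriction. *)
move=> z zD; rewrite potential_mrestr; apply: DM; apply: contrapT => Cz.
have := zD (~` C) (conj (closed_openC cC) Cz).
by rewrite /= /mrestr (_ : _ `&` _ = set0) ?measure0 ?ltxx//; exact/disjoints_subset/subsetC.
Qed.

End maximum_principle.

(** * Necessity *)

Section lower_bound.
Context {R : realType} {T : ptopologicalType}.
Variables (G : T -> T -> \bar R) (h : R).
Hypothesis T2c : @second_countable T.
Hypothesis G0 : forall x y, 0 <= G x y.
Hypothesis lscG : lower_semicontinuous (fun xy : T * T => G xy.1 xy.2).
Hypothesis h1 : (1 <= h)%R.
Hypothesis wmp : weak_maximum_principle h G.
Variable sigma : {measure set (borel T) -> \bar R}.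
Hypothesis lsigma : locally_finite sigma.

(** The threshold [u x / (2 h)], raised to the power [r], contributes [(2 h) ^ (- r)]; the half of
    [u x] coming from above it contributes 1/2. *)
Definition lower_constant (r : R) : R := ((2 * h)^-1 `^ r / 2)%R.

Let h0 : (0 < h)%R. Proof. exact: lt_le_trans h1. Qed.

Lemma lower_constant_gt0 r : (0 < lower_constant r)%R.
Proof. by rewrite divr_gt0// powR_gt0// invr_gt0 mulr_gt0. Qed.

(* At a given [x], the points where the potential [u] is at most [u x / (2 h)]
   contribute at most half of [u x], by the maximum principle. *)
Lemma potential_power_le (F : set (borel T)) (r : R) (x : T)
    (u := fun x : T => \int[sigma]_(y in F) G x y) :
  measurable F -> (0 < r)%R -> u x < +oo ->
  (lower_constant r)%:E * u x `^ (r + 1) <=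
  \int[sigma]_(y in F) (u y `^ r * G x y).
Proof.
move=> mF r0 uxoo.
have u0 z : 0 <= u z by exact: integral_ge0.
have mu_ E : measurable_fun E (u : borel T -> _).
  exact: measurable_integral_kernel.
have mGx E : measurable_fun E (G x : borel T -> _).
  by apply: measurable_funTS; exact: measurable_kernel_section.
have mur E : measurable_fun E (fun y : borel T => u y `^ r).
  exact: (measurableT_comp (measurable_poweR r) (mu_ E)).
have [ux0|ux0] := eqVneq (u x) 0.
  rewrite ux0 poweR0r ?mule0 ?gt_eqF ?addr_gt0//.
  by apply: integral_ge0 => y _; rewrite mule_ge0// poweR_ge0.
have := u0 x; move: uxoo ux0; case uxE : (u x) => [v| |]// _ vN0 v0.
have {vN0 v0} v0 : (0 < v)%R by rewrite lt_neqAle eq_sym -lee_fin v0 andbT.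
pose t := (v / (2 * h))%R.
have t0 : (0 < t)%R by rewrite divr_gt0// mulr_gt0.
pose E : set (borel T) := [set y | u y <= t%:E].
have cE : closed (E : set T) by apply: closed_lsc_le; exact: lsc_integral_kernel.
have mE : measurable E.
  by rewrite -(setCK E); apply: measurableC; apply: open_borel_measurable; exact: closed_openC.
have mFE := measurableI F E mF mE.
have mFnE := measurableD mF mE.
have small : \int[sigma]_(y in F `&` E) G x y <= (v / 2)%:E.
  have -> : (v / 2 = h * t)%R by rewrite /t; field; rewrite gt_eqF.
  apply: (integral_kernel_le _ _ _ _ _ t0 mFE cE) => // z zE.
  apply: le_trans zE; apply: ge0_subset_integral => //.
  by apply: measurable_funTS; exact: measurable_kernel_section.
(* Splitting [v = u x] over [F] inside and outside [E], the finite bound [v / 2] for the inner part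
   cancels and leaves the other half. *)
have big : (v / 2)%:E <= \int[sigma]_(y in F `\` E) G x y.
  rewrite -(@leeD2lE _ (v / 2)%:E)// -EFinD -splitr -uxE /u -[in leLHS](setUIDK F E).
  rewrite ge0_integral_setU//; first exact: leeD2r.
  by apply/disj_set2P; rewrite setDE setIACA setICr setI0.
(* Outside [E] the weight [u ^ r] is at least [t ^ r]. *)
apply: (@le_trans _ _ ((t `^ r)%:E * \int[sigma]_(y in F `\` E) G x y)).
  apply: (@le_trans _ _ ((t `^ r)%:E * (v / 2)%:E)).
    rewrite -EFinM lee_fin /lower_constant /t powRD ?gt_eqF ?addr_gt0 ?implybT//.
    rewrite powRr1 ?(ltW v0)// powRM ?invr_ge0 ?mulr_ge0 ?(ltW h0) ?(ltW v0)//.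
    by rewrite le_eqVlt; apply/orP; left; apply/eqP; field.
  by apply: lee_wpmul2l => //; rewrite lee_fin powR_ge0.
rewrite -ge0_integralZl ?lee_fin ?powR_ge0//.
apply: (@le_trans _ _ (\int[sigma]_(y in F `\` E) (u y `^ r * G x y))).
  apply: ge0_le_integral => //.
  - by move=> y _; rewrite mule_ge0// lee_fin powR_ge0.
  - by apply: emeasurable_funM.
  - by apply: emeasurable_funM.
  move=> y [Fy /negP]; rewrite -ltNge => ty; apply: lee_wpmul2r => //.
  by rewrite -poweR_EFin; apply: le_poweR; rewrite ?(ltW r0) ?lee_fin ?(ltW t0) ?(ltW ty).
apply: ge0_subset_integral => //; first by apply: emeasurable_funM.
by move=> y _; rewrite mule_ge0// poweR_ge0.
Qed.

End lower_bound.

(** * From the pointwise bound to the integral bound *)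

Section necessity.
Context {R : realType} {T : ptopologicalType}.
Variables (G : T -> T -> \bar R) (h q kappa : R).
Hypothesis T2c : @second_countable T.
Hypothesis G0 : forall x y, 0 <= G x y.
Hypothesis lscG : lower_semicontinuous (fun xy : T * T => G xy.1 xy.2).
Hypothesis h1 : (1 <= h)%R.
Hypothesis wmp : weak_maximum_principle h G.
Hypothesis q01 : (0 < q < 1)%R.
Hypothesis kappa0 : (0 < kappa)%R.
Variable sigma : {measure set (borel T) -> \bar R}.
Hypothesis lsigma : locally_finite sigma.
Hypothesis strong : strong_type_inequality sigma G q kappa.

Let r := (q / (1 - q))%R.
(** The bound that [powR_self_bound] yields for [k = kappa] and [c = lower_constant h r]. It does
    not depend on the set of integration, so it survives exhaustion. *)
Let B := ((kappa / lower_constant h r) `^ r)%R.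
Let q0 : (0 < q)%R. Proof. by case/andP: q01. Qed.
Let qN0 : (q != 0)%R. Proof. by rewrite gt_eqF. Qed.
Let r0 : (0 < r)%R.
Proof. by rewrite divr_gt0// subr_gt0; case/andP: q01. Qed.
Let rq : ((r + 1) * q = r)%R.
Proof. by rewrite /r; field; rewrite subr_eq0 gt_eqF//; case/andP: q01. Qed.

Let c0 : (0 < lower_constant h r)%R. Proof. exact: lower_constant_gt0. Qed.

Let mk (D E : set (borel T)) : measurable D ->
  measurable_fun E (fun x => \int[sigma]_(y in D) G x y).
Proof. exact: measurable_integral_kernel. Qed.

Let k0 (D : set (borel T)) x : 0 <= \int[sigma]_(y in D) G x y.
Proof. exact: integral_ge0. Qed.

Let mkr (D E : set (borel T)) p : measurable D ->
  measurable_fun E (fun x => (\int[sigma]_(y in D) G x y) `^ p).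
Proof. by move=> mD; exact: (measurableT_comp (measurable_poweR p) (@mk D E mD)). Qed.

Lemma strong_type_power nu : locally_finite nu ->
  \int[sigma]_x (potential G nu x `^ q) <= (kappa%:E * nu setT) `^ q.
Proof.
move=> lnu; have := strong lnu.
have p0 x : 0 <= potential G nu x by exact: integral_ge0.
have := poweR_Lnorm sigma (potential G nu) qN0.
under [in X in _ = X -> _]eq_integral => x _ do rewrite gee0_abs//.
by move=> <-; apply: le_poweR (ltW q0) (Lnorm_ge0 _ _ _).
Qed.

(** Finite measure and a bounded potential make the integral [I] finite, so that
    [c ^ q * I <= (kappa * I) ^ q] can be solved for it. *)
Lemma integral_power_bound_bounded (F : set (borel T)) (M : R) :
  measurable F -> sigma F < +oo ->
  (forall x, F x -> \int[sigma]_(y in F) G x y <= M%:E) ->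
  \int[sigma]_(x in F) ((\int[sigma]_(y in F) G x y) `^ r) <= B%:E.
Proof.
move=> mF Foo uM; set u := fun x : T => \int[sigma]_(y in F) G x y.
pose f : borel T -> \bar R := (fun x => u x `^ r) \_ F.
have ur0 x : 0 <= u x `^ r by exact: poweR_ge0.
have f0 x : 0 <= f x by exact: erestrict_ge0.
have mf : measurable_fun [set: borel T] f.
  by apply/(measurable_restrictT _ mF); exact: (@mkr F F r mF).
have uoo x : F x -> u x < +oo by move=> /uM /le_lt_trans; apply; exact: ltry.
have ffin x : f x \is a fin_num.
  rewrite /f patchE; case: ifPn => // /[!inE] Fx.
  by rewrite ge0_fin_numE//; apply: poweR_lty; exact: uoo.
pose nu : {measure set (borel T) -> \bar R} := density_measure sigma mf f0.
set I := \int[sigma]_(x in F) _.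
have nuT : nu setT = I by rewrite /nu/= /density_measure /mdensity -integral_mkcond.
have I0 : 0 <= I by apply: integral_ge0 => x _; exact: ur0.
have Ifin : I \is a fin_num.
  rewrite ge0_fin_numE//.
  apply: (@le_lt_trans _ _ (\int[sigma]_(x in F) cst (M%:E `^ r) x)).
    apply: ge0_le_integral => //.
    - by move=> x _; exact: poweR_ge0.
    - exact: (@mkr F F r mF).
    move=> x Fx.
    by apply: le_poweR (ltW r0) (k0 _ _) (uM x Fx).
  by rewrite integral_cst// poweR_EFin lte_mul_pinfty// lee_fin powR_ge0.
have lnu : locally_finite nu.
  by apply: finite_locally_finite; rewrite nuT ltey_eq Ifin.
have potE x : potential G nu x = \int[sigma]_(y in F) (u y `^ r * G x y).
  rewrite /potential ge0_integral_density//; last exact: measurable_kernel_section.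
  rewrite [RHS]integral_mkcond; apply: eq_integral => y _.
  by rewrite /f !patchE; case: ifPn => _; rewrite ?mule0// muleC.
(* The pointwise bound on [F] is raised to the power [q], where [(r + 1) * q = r] restores [u ^ r];
   the strong type inequality for [nu] closes the estimate. *)
have lower : (lower_constant h r `^ q)%:E * I <= (kappa%:E * I) `^ q.
  rewrite -[in leRHS]nuT; apply: le_trans (strong_type_power lnu).
  rewrite -ge0_integralZl ?lee_fin ?powR_ge0//; last 2 first.
  - exact: (@mkr F F r mF).
  - by move=> x _; exact: poweR_ge0.
  apply: (@le_trans _ _ (\int[sigma]_(x in F) (potential G nu x `^ q))); last first.
    apply: ge0_subset_integral => //; last by move=> x _; exact: poweR_ge0.
    apply: (measurableT_comp (measurable_poweR q)).
    by apply: lsc_borel_measurable; exact: lsc_potential.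
  apply: ge0_le_integral => //.
  - by move=> x _; apply: mule_ge0; rewrite ?poweR_ge0// lee_fin powR_ge0.
  - by apply: emeasurable_funM => //; exact: (@mkr F F r mF).
  - apply: measurable_funTS; apply: (measurableT_comp (measurable_poweR q)).
    by apply: lsc_borel_measurable; exact: lsc_potential.
  move=> x Fx; have -> : u x `^ r = (u x `^ (r + 1)) `^ q by rewrite -poweRrM rq.
  rewrite -poweR_EFin -poweRM ?poweR_ge0 ?lee_fin ?(ltW c0)//.
  apply: le_poweR (ltW q0) _ _.
    by rewrite mule_ge0 ?poweR_ge0// lee_fin ltW.
  by rewrite potE; apply: potential_power_le => //; exact: uoo.
move: Ifin I0 lower; move: I {nuT} => [i| |]// _; rewrite !lee_fin => i0 lower.
exact: powR_self_bound.
Qed.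

(** Monotone convergence is used twice: the inner set grows first, with the outer one frozen at
    [F m], and then the outer one grows. *)
Lemma integral_power_bound_bigcup (F : (set (borel T))^nat) :
  nondecreasing_seq F -> (forall n, measurable (F n)) ->
  (forall n, \int[sigma]_(x in F n) ((\int[sigma]_(y in F n) G x y) `^ r) <= B%:E) ->
  \int[sigma]_(x in \bigcup_n F n)
    ((\int[sigma]_(y in \bigcup_n F n) G x y) `^ r) <= B%:E.
Proof.
move=> ndF mF FB; set U := \bigcup_n F n.
have mU : measurable U by exact: bigcup_measurable.
have mGx E x : measurable_fun E (G x : borel T -> _).
  by apply: measurable_funTS; exact: measurable_kernel_section.
have subF m n : (m <= n)%N -> F m `<=` F n by move=> mn; apply/subsetPset/ndF.
have inner m : \int[sigma]_(x in F m) ((\int[sigma]_(y in U) G x y) `^ r) <= B%:E.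
  have cvgu x : (\int[sigma]_(y in F n) G x y) `^ r @[n --> \oo] -->
      (\int[sigma]_(y in U) G x y) `^ r.
    apply: nondecreasing_cvg_poweR => //.
      by move=> a b ab; apply: ge0_subset_integral => //; exact: subF.
    exact: ge0_nondecreasing_set_cvg_integral.
  have ndu x : nondecreasing_seq (fun n => (\int[sigma]_(y in F n) G x y) `^ r).
    move=> a b ab; apply: le_poweR (ltW r0) (k0 _ _) _.
    by apply: ge0_subset_integral => //; exact: subF.
  have cv : \int[sigma]_(x in F m) ((\int[sigma]_(y in F n) G x y) `^ r) @[n --> \oo]
      --> \int[sigma]_(x in F m) ((\int[sigma]_(y in U) G x y) `^ r).
    rewrite (_ : \int[sigma]_(x in F m) ((\int[sigma]_(y in U) G x y) `^ r) =
      \int[sigma]_(x in F m) limn (fun n => (\int[sigma]_(y in F n) G x y) `^ r)).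
      apply: cvg_monotone_convergence => // [n|n x _]; last exact: poweR_ge0.
      exact: (@mkr (F n) (F m) r (mF n)).
    by apply: eq_integral => x _; apply/esym/cvg_lim => //; exact: cvgu.
  rewrite -(cvg_lim _ cv)//; apply: lime_le; first by apply/cvg_ex; eexists; exact: cv.
  near=> n; apply: le_trans (FB n).
  apply: ge0_subset_integral => //.
  - exact: (@mkr (F n) (F n) r (mF n)).
  - by move=> x _; exact: poweR_ge0.
  - by apply: subF; near: n; exists m.
have := @ge0_nondecreasing_set_cvg_integral _ _ _ F
  (fun x => (\int[sigma]_(y in U) G x y) `^ r) sigma ndF mF
  (fun i => @mkr U (F i) r mU) (fun _ _ _ => poweR_ge0 _ _).
move=> cv; rewrite -(cvg_lim _ cv)//; apply: lime_le; first by apply/cvg_ex; eexists; exact: cv.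
by apply: nearW => n; exact: inner.
Unshelve. all: by end_near. Qed.

(** Tested on the finite measure [sigma] restricted to [K], the strong type inequality makes the
    [q]-th power of its potential integrable, hence finite almost everywhere. *)
Lemma integral_kernel_lty_ae (K : set (borel T)) : measurable K -> sigma K < +oo ->
  sigma [set x | \int[sigma]_(y in K) G x y = +oo] = 0.
Proof.
move=> mK Koo; have muT : mrestr sigma mK setT = sigma K by rewrite /mrestr setTI.
have muoo : mrestr sigma mK setT < +oo by rewrite muT.
have := strong_type_power (finite_locally_finite muoo).
under eq_integral => x _ do rewrite potential_mrestr//.
rewrite /= muT => le.
have : sigma.-integrable setT (fun x => (\int[sigma]_(y in K) G x y) `^ q).
  apply/integrableP; split; first exact: (@mkr K _ q mK).
  under eq_integral => x _ do rewrite gee0_abs ?poweR_ge0//.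
  by apply: (le_lt_trans le); apply: poweR_lty; rewrite lte_mul_pinfty// lee_fin ltW.
move=> /(integrable_ae measurableT)[N [mN N0 subN]].
apply/eqP; rewrite eq_le measure_ge0 andbT -N0; apply: le_measure; rewrite ?inE//.
  have := @mk K setT mK measurableT [set +oo] (emeasurable_set1 _).
  by rewrite setTI.
move=> x /= xoo; apply: subN => /=.
by move=> /(_ Logic.I); rewrite xoo poweRyr.
Qed.

(** Two nested exhaustions: the space minus the null set [Z] by sets [F n] of finite measure with
    finite potential on them, and each [F n] by sublevels [H m], on which the potential of [H m] is
    at most [m]. *)
Lemma integral_power_potential_le : \int[sigma]_x (potential G sigma x `^ r) <= B%:E.
Proof.
have [K [KT ndK mK]] := (sigma_finiteP _ _).1 (locally_finite_sigma_finite T2c lsigma).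
pose Z := \bigcup_n [set x : borel T | \int[sigma]_(y in K n) G x y = +oo].
have mZn n : measurable [set x : borel T | \int[sigma]_(y in K n) G x y = +oo].
  have := @mk (K n) setT (mK n).1 measurableT [set +oo] (emeasurable_set1 _).
  by rewrite setTI.
have mZ : measurable Z by exact: bigcup_measurable.
have Z0 : sigma Z = 0.
  apply/eqP; rewrite eq_le measure_ge0 andbT.
  apply: (le_trans (measure_sigma_subadditive _ _ mZ (@subset_refl _ _))) => //.
  rewrite eseries0// => n _ _; apply: integral_kernel_lty_ae; exact: (mK n).1 || exact: (mK n).2.
pose F n := K n `\` Z.
have mF n : measurable (F n) by apply: measurableD => //; exact: (mK n).1.
have ndF : nondecreasing_seq F.
  by move=> m n mn; apply/subsetPset; apply: setSD; apply/subsetPset; exact: ndK.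
have mGx E x : measurable_fun E (G x : borel T -> _).
  by apply: measurable_funTS; exact: measurable_kernel_section.
have FB n : \int[sigma]_(x in F n) ((\int[sigma]_(y in F n) G x y) `^ r) <= B%:E.
  pose H m := F n `&` [set x | \int[sigma]_(y in F n) G x y <= m%:R%:E].
  have mH m : measurable (H m).
    apply: measurableI => //; rewrite -[X in measurable X]setTI.
    exact: (@emeasurable_fun_infty_c _ _ _ _ _ _ (@mk (F n) setT (mF n))).
  have HF : F n = \bigcup_m H m.
    apply/seteqP; split => [x Fx|x [m _ []]//].
    have xoo : \int[sigma]_(y in F n) G x y < +oo.
      apply: (@le_lt_trans _ _ (\int[sigma]_(y in K n) G x y)).
        by apply: ge0_subset_integral => //; [exact: (mK n).1|exact: subDsetl].
      rewrite ltey; apply/eqP => Koo; case: Fx => _; apply; exists n => //.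
    move: (k0 (F n) x) xoo; rewrite /H; case E : (integral _ _ _) => [v| |]//.
    rewrite lee_fin => v0 _.
    exists (Num.truncn v).+1 => //; split => //=.
    by rewrite E lee_fin ltW// truncnS_gt.
  rewrite HF; apply: integral_power_bound_bigcup => //.
    move=> a b ab; apply/subsetPset => x [Fx /= le]; split => //=.
    by apply: (le_trans le); rewrite lee_fin ler_nat.
  move=> m; apply: (@integral_power_bound_bounded _ m%:R) => //.
    apply: le_lt_trans (mK n).2; apply: le_measure; rewrite ?inE//; first exact: (mK n).1.
    by move=> x [[]].
  move=> x [Fx /=]; apply: le_trans; apply: ge0_subset_integral => //.
  by move=> z [].
have FZ : \bigcup_n F n = setT `\` Z by rewrite /F -setD_bigcupl -KT.
have := integral_power_bound_bigcup ndF mF FB; rewrite FZ.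
(* Removing the null set [Z] changes neither the inner integral nor, below, the outer one. *)
have pE x : \int[sigma]_(y in setT `\` Z) G x y = potential G sigma x.
  by rewrite -ge0_negligible_integral.
under eq_integral => x _ do rewrite pE.
rewrite -ge0_negligible_integral//.
  apply: (measurableT_comp (measurable_poweR r)).
  by apply: lsc_borel_measurable; exact: lsc_potential.
by move=> x _; exact: poweR_ge0.
Qed.

Lemma in_Lp_potential : in_Lp sigma (q / (1 - q)) (potential G sigma).
Proof.
split; first by apply: lsc_borel_measurable; exact: lsc_potential.
rewrite unlock; apply: poweR_lty.
under eq_integral => x _ do rewrite gee0_abs ?integral_ge0//.
by apply: (le_lt_trans integral_power_potential_le); exact: ltry.
Qed.

End necessity.

(** * Sufficiency *)

(** Tonelli exchanges the variables; measurability in the first variable then comes from the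
    transposed kernel. *)
Lemma lower_semicontinuous_transpose {R : realType} {T : topologicalType}
    (G : T -> T -> \bar R) :
  lower_semicontinuous (fun xy : T * T => G xy.1 xy.2) ->
  lower_semicontinuous (fun xy : T * T => G xy.2 xy.1).
Proof.
move=> lscG [x y] r rG.
have [V [[A B] /= [Ax By] ABV] VG] := (lscG : forall xy r, _) ((y, x) : T * T) r rG.
exists (B `*` A); first by exists (B, A).
by move=> [x' y'] /= [Bx' Ay']; apply: (VG (y', x')); exact: ABV.
Qed.

Section sufficiency.
Context {R : realType} {T : ptopologicalType}.
Variables (G : T -> T -> \bar R) (h q a : R).
Hypothesis T2c : @second_countable T.
Hypothesis G0 : forall x y, 0 <= G x y.
Hypothesis lscG : lower_semicontinuous (fun xy : T * T => G xy.1 xy.2).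
Hypothesis h1 : (1 <= h)%R.
Hypothesis wmp : weak_maximum_principle h G.
Hypothesis q01 : (0 < q < 1)%R.
Hypothesis a0 : (0 < a)%R.
Hypothesis Ga : forall x y, G x y <= a%:E * G y x.
Variable sigma : {measure set (borel T) -> \bar R}.
Hypothesis lsigma : locally_finite sigma.

Let q0 : (0 < q)%R. Proof. by case/andP: q01. Qed.
Let q1 : (0 < 1 - q)%R. Proof. by rewrite subr_gt0; case/andP: q01. Qed.

Let u : T -> \bar R := potential G sigma.

Let u0 x : 0 <= u x. Proof. exact: integral_ge0. Qed.

Let mpot nu D : measurable_fun D (potential G nu : borel T -> \bar R).
Proof.
by apply: measurable_funTS; apply: lsc_borel_measurable; exact: lsc_potential.
Qed.

(** Tonelli integrates [G x y] over [x] in [D] first. Quasi-symmetry turns this into the potential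
    at [y] of [sigma] restricted to [D], at the cost of [a], and the maximum principle bounds that
    by [h t] for every [y]. *)
Lemma integral_potential_sublevel_le nu (D : set (borel T)) (t : R) :
  locally_finite nu -> measurable D -> (0 < t)%R -> (forall x, D x -> u x <= t%:E) ->
  \int[sigma]_(x in D) potential G nu x <= (a * (h * t))%:E * nu setT.
Proof.
move=> lnu mD t0 Dt.
have cC : closed [set x : T | u x <= t%:E] by apply: closed_lsc_le; exact: lsc_potential.
have DG x : \int[sigma]_(y in D) G x y <= (h * t)%:E.
  apply: (integral_kernel_le T2c G0 lscG wmp lsigma t0 mD cC Dt) => z zt.
  apply: le_trans zt; apply: ge0_subset_integral => //.
  exact: measurable_kernel_section.
rewrite -ge0_integral_mrestr//; last by move=> x; exact: integral_ge0.
rewrite (tonelli_sigma_finite (f := fun z : borel T * borel T => G z.1 z.2)); last 4 first.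
- by apply: locally_finite_sigma_finite => //; exact: locally_finite_mrestr.
- exact: locally_finite_sigma_finite.
- exact: measurable_kernel.
- by [].
pose Gt x y := G y x.
have lscGt : lower_semicontinuous (fun xy : T * T => Gt xy.1 xy.2).
  exact: lower_semicontinuous_transpose.
have Gt0 x y : 0 <= Gt x y by exact: G0.
have mGD : measurable_fun [set: borel T] (potential Gt (mrestr sigma mD) : borel T -> \bar R).
  by apply: lsc_borel_measurable; exact: lsc_potential.
rewrite -integral_cst//=; apply: ge0_le_integral => //.
  by move=> y _; exact: integral_ge0.
move=> y _.
have mGr : measurable_fun setT (fun x : borel T => G x y).
  exact: (measurable_kernel_section T2c lscGt).
rewrite ge0_integral_mrestr//.
apply: (@le_trans _ _ (\int[sigma]_(x in D) (a%:E * G y x))).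
  apply: ge0_le_integral => //.
  - exact: measurable_funTS.
  - by apply: measurable_funeM; apply: measurable_funTS; exact: measurable_kernel_section.
rewrite ge0_integralZl ?lee_fin ?(ltW a0)//; last first.
  by apply: measurable_funTS; exact: measurable_kernel_section.
by rewrite EFinM lee_wpmul2l// lee_fin ltW.
Qed.

(** * The Lorentz integral on geometric levels *)

Definition distribution_fun (f : T -> \bar R) (t : R) : \bar R :=
  sigma [set x : borel T | t%:E < f x].

(** For [s = q / (1 - q)] the exponent [q / s] of the Lorentz integral is [1 - q]. *)
Definition lorentz_integrand (f : T -> \bar R) (t : R) : \bar R :=
  (t `^ (q - 1))%:E * distribution_fun f t `^ (1 - q).

Let m := distribution_fun u.
Let phi := lorentz_integrand u.
Let e (k : int) : R := expR k%:~R.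

Let e0 k : (0 < e k)%R. Proof. exact: expR_gt0. Qed.

Let eS k : e (k + 1) = (expR 1 * e k)%R.
Proof. by rewrite /e intrD addrC expRD. Qed.

Let mlvl t : measurable [set x : borel T | t%:E < u x].
Proof.
apply: open_borel_measurable.
have lu : lower_semicontinuous u by exact: lsc_potential.
exact: (lower_semicontinuousP u).1 lu t.
Qed.

Let le_m s t : (s <= t)%R -> m t <= m s.
Proof.
move=> st; apply: le_measure; rewrite ?inE//.
by move=> x /=; apply: le_lt_trans; rewrite lee_fin.
Qed.

Let m0 t : 0 <= m t. Proof. exact: measure_ge0. Qed.

Let phi0 t : 0 <= phi t.
Proof. by rewrite mule_ge0 ?poweR_ge0// lee_fin powR_ge0. Qed.

Let mphi (D : set R) : measurable_fun D phi.
Proof.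
apply: measurable_funTS; apply: emeasurable_funM.
  by apply/measurable_EFinP; exact: measurable_powR.
apply: (measurableT_comp (measurable_poweR _)).
apply: (measurability _ (ErealGenOInfty.measurableE R)).
move=> /= _ [_ [b ->]] <-; rewrite setTI preimage_itvoy.
(* As [m] is nonincreasing, the preimage of an upper ray is an interval. *)
apply: is_interval_measurable => x y /= _ by_ z /andP[_ zy].
by apply: (lt_le_trans by_); exact: le_m.
Qed.

(** This interval ends at [e k], where the values of [u] on the shell [D k] begin, so on it the
    distribution function is at least [m (e k)], hence at least [sigma (D k)]. *)
Let I k : set R := `]e (k - 1), e k]%classic.

(** The length of [I k] is [c1 * e k]. *)
Let c1 : R := (1 - expR (-1))%R.

Let c1_gt0 : (0 < c1)%R.
Proof. by rewrite subr_gt0 -[X in (_ < X)%R]expR0 ltr_expR ltrN10. Qed.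

(** Since [q < 1], both factors of [phi] are nonincreasing, so on [I k] each is at least its value
    at the right end [e k]. *)
Lemma le_integral_lorentz_shell k :
  (c1 * e k `^ q)%:E * m (e k) `^ (1 - q) <= \int[lebesgue_measure]_(t in I k) phi t.
Proof.
have eB : e (k - 1) = (expR (-1) * e k)%R by rewrite /e intrD addrC expRD.
have eBk : (e (k - 1) < e k)%R by rewrite ltr_expR ltr_int ltrBlDr ltrDl.
have lI : lebesgue_measure (I k) = (e k - e (k - 1))%:E.
  by rewrite lebesgue_measure_itv/= lte_fin eBk EFinB.
apply: (@le_trans _ _ (\int[lebesgue_measure]_(t in I k)
    cst ((e k `^ (q - 1))%:E * m (e k) `^ (1 - q)) t)).
  rewrite integral_cst; last exact: measurable_itv.
  rewrite -[X in _ <= _ * X]/(lebesgue_measure (I k)) lI muleAC -EFinM.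
  apply: lee_wpmul2r; first exact: poweR_ge0.
  rewrite lee_fin eB /c1 le_eqVlt; apply/orP; left; apply/eqP.
  have ekN0 : e k != 0%R by rewrite gt_eqF.
  by rewrite powRB ?ekN0 ?implybT// powRr1 ?(ltW (e0 k))//; field.
apply: ge0_le_integral => //.
- exact: measurable_itv.
- by move=> t _; apply: mule_ge0; rewrite ?poweR_ge0// lee_fin powR_ge0.
- exact: mphi.
move=> t; rewrite /cst /I /= in_itv/= => /andP[et te].
have t0 : (0 < t)%R by exact: lt_trans et.
apply: lee_pmul; rewrite ?poweR_ge0 ?lee_fin ?powR_ge0//; last first.
  by apply: le_poweR (ltW q1) (m0 _) (le_m te).
rewrite -opprB !powRN lef_pV2 ?posrE ?powR_gt0//.
by rewrite ge0_ler_powR// ?nnegrE ?ltW.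
Qed.

Let D k : set (borel T) := [set x | (e k)%:E < u x <= (e (k + 1))%:E].

Let mD k : measurable (D k).
Proof.
rewrite (_ : D k = [set x | (e k)%:E < u x] `\` [set x | (e (k + 1))%:E < u x]).
  exact: measurableD.
apply/seteqP; split => x /=.
  by move=> /andP[ek ek1]; split => //; apply/negP; rewrite -leNgt.
by move=> [ek /negP]; rewrite -leNgt => ek1; apply/andP.
Qed.

(** The bound on the integral of the potential over [D k] is interpolated with [m (e k)]. The 2
    comes from interpolation, [expR 1] from passing from [e (k + 1)] to [e k], and [c1] from the
    length of [I k]. *)
Lemma integral_potential_shell_le nu (N : R) k :
  locally_finite nu -> (0 < N)%R -> nu setT = N%:E ->
  \int[sigma]_(x in D k) (potential G nu x `^ q) <=
  (2 * (a * h * expR 1 * N) `^ q / c1)%:E * \int[lebesgue_measure]_(t in I k) phi t.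
Proof.
move=> lnu N0 nuN.
have h0 : (0 < h)%R by exact: lt_le_trans h1.
have C0 : (0 < 2 * (a * h * expR 1 * N) `^ q / c1)%R.
  by rewrite divr_gt0// mulr_gt0// powR_gt0// !mulr_gt0// expR_gt0.
have Dm : sigma (D k) <= m (e k).
  by apply: le_measure; rewrite ?inE// => x /andP[].
have intD : \int[sigma]_(x in D k) potential G nu x <= (a * (h * e (k + 1)) * N)%:E.
  by rewrite EFinM -nuN; apply: integral_potential_sublevel_le => // x /andP[].
have pot0 x : 0 <= potential G nu x by exact: integral_ge0.
have mpq : measurable_fun (D k) (fun x : borel T => potential G nu x `^ q).
  exact: (measurableT_comp (measurable_poweR q) (@mpot nu (D k))).
have := le_integral_lorentz_shell k; have := m0 (e k).
(* Interpolation needs [m (e k)] positive and finite. If it is 0 the shell is null; if it is [+oo]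
   so is the integral over [I k]. *)
case mE : (m (e k)) => [s| |]//.
- rewrite lee_fin le_eqVlt => /predU1P[s0 _|s0 shell].
    rewrite null_set_integral//; last first.
      by apply/eqP; rewrite eq_le measure_ge0 andbT (le_trans Dm)// mE -s0.
    by rewrite mule_ge0 ?lee_fin ?(ltW C0)//; exact: integral_ge0.
  have A0 : (0 < a * (h * e (k + 1)) * N)%R by rewrite !mulr_gt0.
  rewrite mE in Dm.
  apply: (le_trans (integral_poweR_le q01 A0 s0 (mD k) (@mpot nu (D k)) pot0 Dm intD)).
  apply: le_trans (lee_wpmul2l _ shell); last by rewrite lee_fin ltW.
  rewrite poweR_EFin -!EFinM lee_fin eS.
  rewrite (_ : a * (h * (expR 1 * e k)) * N = (a * h * expR 1 * N) * e k)%R; last by ring.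
  rewrite powRM ?(ltW (e0 k))//; last by rewrite ltW// !mulr_gt0// expR_gt0.
  by rewrite le_eqVlt; apply/orP; left; apply/eqP; field; rewrite gt_eqF.
- move=> _; rewrite poweRyr ?gt_eqF// gt0_muley; last first.
    by rewrite lte_fin mulr_gt0// powR_gt0.
  by rewrite leye_eq => /eqP ->; rewrite gt0_muley ?leey// lte_fin.
Qed.

(** * Summation over the shells *)

Hypothesis lorentz : \int[lebesgue_measure]_(t in `]0%R, +oo[) phi t < +oo.
Hypothesis unull : sigma [set x : borel T | u x = 0] = 0.

Let L := \int[lebesgue_measure]_(t in `]0%R, +oo[) phi t.

Let L0 : 0 <= L. Proof. exact: integral_ge0. Qed.

Let I_pos k : I k `<=` `]0%R, +oo[%classic.
Proof.
move=> t; rewrite /I /= !in_itv/= andbT => /andP[+ _].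
by apply: lt_trans; exact: e0.
Qed.

Let mI k : measurable (I k). Proof. exact: measurable_itv. Qed.

(** The set [S] lies above every level [e k], so [c1 * e k ^ q * sigma S ^ (1 - q) <= L] for all
    [k]; letting [k] grow forces [sigma S = 0]. *)
Lemma lorentz_infty_null : sigma [set x : borel T | u x = +oo] = 0.
Proof.
set S := [set x | _].
have mS : measurable S.
  have := @mpot sigma setT measurableT [set +oo] (emeasurable_set1 _).
  by rewrite setTI.
apply/eqP; rewrite eq_le measure_ge0 andbT leNgt; apply/negP => S0.
have Sq0 : 0 < sigma S `^ (1 - q) by exact: poweR_gt0.
have shell k : (c1 * e k `^ q)%:E * sigma S `^ (1 - q) <= L.
  apply: (@le_trans _ _ (\int[lebesgue_measure]_(t in I k) phi t)); last first.
    apply: ge0_subset_integral => //.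
      exact: mI.
    exact: mphi.
  apply: le_trans (le_integral_lorentz_shell k).
  apply: lee_wpmul2l; first by rewrite lee_fin mulr_ge0 ?powR_ge0// ltW.
  apply: le_poweR (ltW q1) _ _; first exact: measure_ge0.
  apply: le_measure; rewrite ?inE//.
  by move=> x; rewrite /S /= => ->; exact: ltry.
have {}shell k : (c1 * e k `^ q)%:E * sigma S `^ (1 - q) <= (fine L)%:E.
  by rewrite fineK// ge0_fin_numE.
move: (sigma S `^ (1 - q)) Sq0 shell => [s| |]// s0 shell; last first.
  by have := shell 0%R; rewrite gt0_muley ?lte_fin ?mulr_gt0 ?powR_gt0// leye_eq.
rewrite lte_fin in s0.
(* Chosen so that [c1 * s * q * k] exceeds [L]; then [expR (q * k) >= 1 + q * k] gives the
   contradiction. *)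
pose k := (Num.truncn (fine L / (c1 * s * q))).+1.
have := shell k%:Z; apply/negP; rewrite -ltNge -EFinM lte_fin.
have csq0 : (0 < c1 * s * q)%R by rewrite !mulr_gt0.
have : (fine L / (c1 * s * q) < k%:R)%R by exact: truncnS_gt.
rewrite ltr_pdivrMr// => /lt_trans; apply.
have -> : (e k%:Z `^ q = expR (q * k%:R))%R.
  by rewrite /powR gt_eqF// /e expRK.
rewrite (_ : k%:R * (c1 * s * q) = c1 * (q * k%:R) * s)%R; last by ring.
rewrite ltr_pM2r// ltr_pM2l//.
by apply: lt_le_trans (expR_ge1Dx _); rewrite ltrDr.
Qed.

(** Off the null sets where [u] is 0 or [+oo] the disjoint shells cover the space, and the intervals
    [I k] are disjoint in the positive half-line, so the shell estimates add up. *)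
Lemma integral_potential_le nu (N : R) :
  locally_finite nu -> (0 < N)%R -> nu setT = N%:E ->
  \int[sigma]_x (potential G nu x `^ q) <=
  (2 * (a * h * expR 1 * N) `^ q / c1)%:E * L.
Proof.
move=> lnu N0 nuN.
have h0 : (0 < h)%R by exact: lt_le_trans h1.
have C0 : (0 <= 2 * (a * h * expR 1 * N) `^ q / c1)%R.
  by rewrite divr_ge0 ?mulr_ge0 ?powR_ge0// ltW.
pose Z : set (borel T) := [set x | u x = 0] `|` [set x | u x = +oo].
have mlevel b : measurable [set x : borel T | u x = b].
  have := @mpot sigma setT measurableT [set b] (emeasurable_set1 _).
  by rewrite setTI.
have mZ : measurable Z by exact: measurableU.
have Z0 : sigma Z = 0.
  apply/eqP; rewrite eq_le measure_ge0 andbT.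
  apply: (le_trans (measureU2 sigma (mlevel 0) (mlevel +oo))).
  by rewrite [X in X + _]unull [X in _ + X]lorentz_infty_null adde0.
have mpq E : measurable_fun E (fun x : borel T => potential G nu x `^ q).
  exact: (measurableT_comp (measurable_poweR q) (@mpot nu E)).
have mU : measurable (\bigcup_k D k) by exact: countable_bigcupT_measurable.
have ZD : setT `\` Z `<=` \bigcup_k D k.
  move=> x [_ /not_orP[/= ux0 uxoo]].
  have : 0 < u x by rewrite lt_neqAle eq_sym u0 andbT; apply/eqP.
  move: ux0 uxoo; case uxE : (u x) => [v| |]// _ _; rewrite lte_fin => v0.
  have [w vE] : exists w, v = expR w by exists (ln v); rewrite lnK.
  (* Shells are open below and closed above, hence the index is [ceil w - 1] rather than the floor
     of [w]. *)
  exists (Num.ceil w - 1)%R => //; rewrite /D /= uxE vE /e subrK lte_fin lee_fin.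
  by rewrite ltr_expR ler_expR ceil_itv.
rewrite (ge0_negligible_integral mZ)//; last by move=> x _; exact: poweR_ge0.
apply: (@le_trans _ _ (\int[sigma]_(x in \bigcup_k D k) (potential G nu x `^ q))).
  apply: ge0_subset_integral => //; first exact: measurableD.
  by move=> x _; exact: poweR_ge0.
apply: (@le_trans _ _ ((2 * (a * h * expR 1 * N) `^ q / c1)%:E *
    \int[lebesgue_measure]_(t in \bigcup_k I k) phi t)).
  apply: ge0_integral_bigcup_le => //.
  - move=> k l _ _ [x [/andP[kx xk] /andP[lx xl]]].
    have := lt_le_trans kx xl; have := lt_le_trans lx xk.
    rewrite !lte_fin !ltr_expR !ltr_int !ltzD1 => lk kl.
    by apply/eqP; rewrite eq_le lk kl.
  - move=> k l _ _ [x []]; rewrite /I /= !in_itv/= => /andP[kx xk] /andP[lx xl].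
    have := lt_le_trans kx xl; have := lt_le_trans lx xk.
    rewrite !ltr_expR !ltr_int !ltrBlDr !ltzD1 => lk kl.
    by apply/eqP; rewrite eq_le lk kl.
  - exact: mphi.
  - by move=> x; exact: poweR_ge0.
  - by move=> k; exact: integral_potential_shell_le.
apply: lee_wpmul2l; first by rewrite lee_fin.
apply: ge0_subset_integral => //.
- apply: countable_bigcupT_measurable => [|k]; last exact: mI.
  exact: (@countableP int).
- exact: mphi.
- by move=> t [k _]; exact: I_pos.
Qed.

Lemma strong_type_of_lorentz :
  exists2 kappa : R, (0 < kappa)%R & strong_type_inequality sigma G q kappa.
Proof.
have h0 : (0 < h)%R by exact: lt_le_trans h1.
pose l := fine L; have LE : L = l%:E by rewrite fineK// ge0_fin_numE.
have l0 : (0 <= l)%R by rewrite -lee_fin -LE.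
(* Taking [l + 1] instead of [l] keeps [kappa] positive when the Lorentz integral vanishes. *)
pose b := (2 / c1 * (l + 1))%R.
have b0 : (0 < b)%R by rewrite mulr_gt0 ?divr_gt0// ltr_wpDl.
pose kappa := (b `^ q^-1 * (a * h * expR 1))%R.
have ahe0 : (0 < a * h * expR 1)%R by rewrite !mulr_gt0 ?expR_gt0.
have kappa0 : (0 < kappa)%R by rewrite mulr_gt0// powR_gt0.
exists kappa => // nu lnu.
have pot0 x : 0 <= potential G nu x by exact: integral_ge0.
have normE : 'N[sigma]_(q%:E)[potential G nu] =
    (\int[sigma]_x (potential G nu x `^ q)) `^ q^-1.
  by rewrite unlock; congr (_ `^ _); apply: eq_integral => x _; rewrite gee0_abs.
(* The shell estimate concerns [nu] of positive finite mass: for zero mass the potential vanishes,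
   for infinite mass the right-hand side is [+oo]. *)
have [nu0|nu0] := eqVneq (nu setT) 0.
  rewrite normE nu0 mule0.
  rewrite (_ : \int[sigma]_x _ = 0) ?poweR0r ?invr_neq0 ?gt_eqF//.
  apply: integral0_eq => x _; rewrite (_ : potential G nu x = 0) ?poweR0r ?gt_eqF//.
  by apply: null_set_integral => //; exact: measurable_kernel_section.
have nuT0 : 0 <= nu setT by exact: measure_ge0.
case nuE : (nu setT) nu0 nuT0 => [N| |] N0 N0' //; last first.
  by rewrite gt0_muley ?leey// lte_fin.
have {N0 N0'} N0 : (0 < N)%R by rewrite lt_neqAle eq_sym -lee_fin N0' andbT.
rewrite normE; have := integral_potential_le lnu N0 nuE; rewrite LE -EFinM => le.
apply: (@le_trans _ _ ((b * (a * h * expR 1 * N) `^ q)%:E `^ q^-1)).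
  apply: le_poweR; rewrite ?invr_ge0 ?(ltW q0)//.
    by apply: integral_ge0 => x _; exact: poweR_ge0.
  apply: (le_trans le); rewrite lee_fin /b.
  rewrite (_ : (2 * (a * h * expR 1 * N) `^ q / c1 * l)%R =
    (2 / c1 * l * (a * h * expR 1 * N) `^ q)%R); last by ring.
  apply: ler_wpM2r; first exact: powR_ge0.
  by apply: ler_wpM2l; [rewrite divr_ge0// ltW|rewrite lerDl].
rewrite poweR_EFin -EFinM lee_fin (powRM _ (ltW b0) (powR_ge0 _ _)).
rewrite -powRrM mulfV ?gt_eqF// powRr1; first by rewrite mulrA.
by rewrite mulr_ge0// ltW.
Qed.

End sufficiency.

(** Where the potential of [sigma] vanishes at [y], [G y] is null almost everywhere and, by
    quasi-symmetry, so is the section [G x y] in [x]. If such [y] had positive measure, they would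
    witness degeneracy. *)
Lemma potential_eq0_null {R : realType} {T : ptopologicalType}
    (G : T -> T -> \bar R) (a : R) (sigma : {measure set (borel T) -> \bar R}) :
  @second_countable T -> (forall x y, 0 <= G x y) ->
  lower_semicontinuous (fun xy : T * T => G xy.1 xy.2) ->
  (forall x y, G x y <= a%:E * G y x) -> ~ degenerate sigma G ->
  sigma [set x : borel T | potential G sigma x = 0] = 0.
Proof.
move=> T2c G0 lscG Ga ndG; apply/eqP; rewrite eq_le measure_ge0 andbT leNgt.
apply/negP => A0; apply: ndG; exists [set x | potential G sigma x = 0]; split => //.
  have lGs : lower_semicontinuous (potential G sigma) by exact: lsc_potential.
  have := lsc_borel_measurable lGs.
  by move=> /(_ measurableT [set 0] (emeasurable_set1 _)); rewrite setTI.
move=> y /= Gy0.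
have mGy : measurable_fun [set: borel T] (G y : borel T -> \bar R).
  exact: measurable_kernel_section.
have := (ae_eq_integral_abs sigma measurableT mGy).1.
under [in X in (X -> _)]eq_integral => x _ do rewrite gee0_abs//.
move=> /(_ Gy0); apply: filterS => x /(_ Logic.I) Gyx.
by apply/eqP; rewrite eq_le G0 andbT (le_trans (Ga x y))// Gyx mule0.
Qed.

Theorem theorem1p2 (R : realType) (Omega : ptopologicalType)
    (sigma : {measure set (borel Omega) -> \bar R})
    (G : Omega -> Omega -> \bar R) (q h : R) :
  locally_compact [set: Omega] ->
  hausdorff_space Omega ->
  @second_countable Omega ->
  locally_finite sigma ->
  (0 < q < 1)%R ->
  (forall x y, 0 <= G x y) ->
  lower_semicontinuous (fun xy : Omega * Omega => G xy.1 xy.2) ->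
  quasi_symmetric G ->
  ~ degenerate sigma G ->
  (1 <= h)%R ->
  weak_maximum_principle h G ->
  ((exists2 kappa : R, (0 < kappa)%R & strong_type_inequality sigma G q kappa) ->
     in_Lp sigma (q / (1 - q)) (potential G sigma))
  /\
  (in_Lorentz sigma (q / (1 - q)) q (potential G sigma) ->
     exists2 kappa : R, (0 < kappa)%R & strong_type_inequality sigma G q kappa).
Proof.
move=> _ _ T2c lsigma q01 G0 lscG [a a0 Ga] ndG h1 wmp; split.
  move=> [kappa kappa0 strong].
  exact: (in_Lp_potential T2c G0 lscG h1 wmp q01 kappa0 lsigma strong).
move=> [_ lorentz].
have {}Ga x y : G x y <= a%:E * G y x by have /andP[] := Ga x y.
apply: (strong_type_of_lorentz T2c G0 lscG h1 wmp q01 a0 Ga lsigma); last first.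
  exact: potential_eq0_null Ga ndG.
(* The two Lorentz integrals agree because the potential is nonnegative and
   [q / (q / (1 - q)) = 1 - q]. *)
rewrite (_ : integral _ _ _ = \int[lebesgue_measure]_(t in `]0%R, +oo[)
  ((t `^ (q - 1))%:E *
   sigma [set x | t%:E < `|potential G sigma x|] `^ (q / (q / (1 - q)))))//.
apply: eq_integral => t _; rewrite /lorentz_integrand /distribution_fun.
congr (_ * _ `^ _).
  by congr (sigma _); apply/seteqP; split => x /=; rewrite gee0_abs// integral_ge0.
have /andP[q0 q1] := q01.
by field; rewrite !gt_eqF ?subr_gt0.
Qed.
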